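(* Suppose the polynomial $f(z)=1+\sum_{|\beta|>0}a(\beta)z^\beta\in\mathbb{C}[z_1,\ldots,z_n]$ is stable and let $$B=2^{n-1}\frac{\sqrt{2e^2-e}}{e-1},\qquad C=6e^2\Big(\sum_{i=1}^n|a(e_i)|\Big)^2+4e^2\sum_{i,j=1}^n|a(e_i+e_j)|.$$ Then $\max\{|f(z)|:|z_i|\le r,\ 1\le i\le n\}\le Be^{Cr^2}$ for all $r\ge0$.
   Context: $H=\{z\in\mathbb{C}:\Im(z)>0\}$; a polynomial is stable if it is non-zero whenever all variables lie in $H$. $e_i$ is the $i$-th standard basis vector of $\mathbb{N}^n$, $|\beta|=\sum\beta_i$, and $a(\beta)=0$ for $\beta$ not in the support of $f$. *)

(* Defs.v *)
From HB Require Import structures.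
From mathcomp Require Import all_boot all_order all_algebra.
From mathcomp Require Import all_classical all_reals all_analysis.
From mathcomp Require Import complex.
From mathcomp Require mpoly.

Set Implicit Arguments.
Unset Strict Implicit.
Unset Printing Implicit Defensive.

Import Order.TTheory GRing.Theory Num.Theory.
Local Open Scope ring_scope.

Definition cmod (R : rcfType) (z : R[i]) : R := Num.sqrt (complex.Re z ^+ 2 + complex.Im z ^+ 2).

Definition stable (R : rcfType) (n : nat) (f : mpoly.mpoly n R[i]) : Prop :=
  forall z : 'I_n -> R[i], (forall i, 0 < complex.Im (z i)) -> mpoly.meval z f != 0.

(* Main.v *)
(* If [q] is a one-variable polynomial without zeros in the upper half-plane,
   comparing factors over the roots gives [|q(-i)| <= |q(i)|]; if moreover all
   zeros satisfy [Im <= -1/2], AM-GM gives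
   [|q(-1)| |q(1/2)|^2 <= |q(3i/8)|^3].  Restricting a stable [f] to lines with
   nonnegative direction, the first inequality says that [|f(x + i y)|] increases
   when [y] is replaced by [Y >= |y|], and the second one, along the direction
   [r - x] from [r + i r], then yields for [|z_j| <= r]
     [|f(z)| |f((1 + i/2) nu)|^2 <= |f((1 + 7i/4) (r, ..., r))|^3],
   where [nu = (3 r - x) / 2] has all its entries in [[r, 2 r]].
   On a ray, [f(t nu)] is the product of the [1 + w_k t] with [Im w_k <= 0], where
   [sum w_k] and [sum w_k^2] are given by the coefficients of degree at most 2;
   since the [Im w_k] have the same sign this controls [sum |w_k|^2], and hence
   [f(t nu)] from above and from below, in the manner of Szasz. *)

Require Import Defs.
From HB Require Import structures.
From mathcomp Require Import all_boot all_order all_algebra.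
From mathcomp Require Import all_classical all_reals all_analysis.
From mathcomp Require Import complex.
From mathcomp Require mpoly.
From mathcomp Require Import ring lra.
Import (canonicals, coercions) mpoly.
Import Order.TTheory GRing.Theory Num.Theory.
Local Open Scope ring_scope.
Local Open Scope complex_scope.

(** * Squared moduli, and one-variable polynomials compared factor by factor over their roots *)

Section SquaredModulus.
Context {R : rcfType}.
Implicit Types (z w : R[i]) (q : {poly R[i]}).

Definition sqmod z : R := complex.Re z ^+ 2 + complex.Im z ^+ 2.

Lemma sqmod_ge0 z : 0 <= sqmod z.
Proof. by rewrite addr_ge0 ?sqr_ge0. Qed.

Lemma sqmodM z w : sqmod (z * w) = sqmod z * sqmod w.
Proof. by case: z w => [a b] [c d]; rewrite /sqmod /=; ring. Qed.

Lemma sqmod0 : sqmod 0 = 0.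
Proof. by rewrite /sqmod /= !expr0n addr0. Qed.

Lemma sqmod1 : sqmod 1 = 1.
Proof. by rewrite /sqmod /= expr1n expr0n addr0. Qed.

Lemma sqmod_gt0 z : (0 < sqmod z) = (z != 0).
Proof.
rewrite lt0r sqmod_ge0 andbT; congr (~~ _).
by rewrite /sqmod paddr_eq0 ?sqr_ge0 // !sqrf_eq0 eq_complex.
Qed.

Lemma sqmod_prod (I : Type) (r : seq I) (F : I -> R[i]) :
  sqmod (\prod_(i <- r) F i) = \prod_(i <- r) sqmod (F i).
Proof. exact: (big_morph _ sqmodM sqmod1). Qed.

Lemma Re_sum (I : Type) (r : seq I) (P : pred I) (F : I -> R[i]) :
  complex.Re (\sum_(i <- r | P i) F i) = \sum_(i <- r | P i) complex.Re (F i).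
Proof. by apply: (big_morph _ _ (erefl : complex.Re 0 = 0)) => -[? ?] []. Qed.

Lemma Im_sum (I : Type) (r : seq I) (P : pred I) (F : I -> R[i]) :
  complex.Im (\sum_(i <- r | P i) F i) = \sum_(i <- r | P i) complex.Im (F i).
Proof. by apply: (big_morph _ _ (erefl : complex.Im 0 = 0)) => -[? ?] []. Qed.

Lemma cmodE z : cmod z = Num.sqrt (sqmod z).
Proof. by []. Qed.

Lemma cmod_ge0 z : 0 <= cmod z.
Proof. exact: sqrtr_ge0. Qed.

Lemma cmod_sqr z : cmod z ^+ 2 = sqmod z.
Proof. by rewrite sqr_sqrtr ?sqmod_ge0. Qed.

Lemma cmodM z w : cmod (z * w) = cmod z * cmod w.
Proof. by rewrite !cmodE sqmodM sqrtrM ?sqmod_ge0. Qed.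

Lemma cmod_normc z : cmod z = ComplexField.Normc.normc z.
Proof. by case: z. Qed.

Lemma cmod0 : cmod (0 : R[i]) = 0.
Proof. by rewrite cmodE sqmod0 sqrtr0. Qed.

Lemma cmod1 : cmod (1 : R[i]) = 1.
Proof. by rewrite cmodE sqmod1 sqrtr1. Qed.

Lemma cmodD z w : cmod (z + w) <= cmod z + cmod w.
Proof. by rewrite !cmod_normc le_normcD. Qed.

Lemma cmod_sum (I : Type) (r : seq I) (P : pred I) (F : I -> R[i]) :
  cmod (\sum_(i <- r | P i) F i) <= \sum_(i <- r | P i) cmod (F i).
Proof.
elim/big_ind2: _ => [|x a y b xa yb|//]; first by rewrite cmod0.
exact: le_trans (cmodD _ _) (lerD xa yb).
Qed.

Lemma normr_Re_le_cmod z : `|complex.Re z| <= cmod z.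
Proof. by rewrite -sqrtr_sqr ler_wsqrtr // lerDl sqr_ge0. Qed.

Lemma normr_Im_le_cmod z : `|complex.Im z| <= cmod z.
Proof. by rewrite -sqrtr_sqr ler_wsqrtr // lerDr sqr_ge0. Qed.

Lemma sqmod_horner_roots q : exists2 r : seq R[i], all (root q) r &
  forall t, sqmod q.[t] = sqmod (lead_coef q) * \prod_(z <- r) sqmod (t - z).
Proof.
have [r qE] := closed_field_poly_normal q; exists r => [|t].
  apply/allP => z zr; rewrite qE rootE hornerZ horner_prod.
  by rewrite (big_rem z zr) /= hornerXsubC subrr mul0r mulr0.
rewrite {1}qE hornerZ horner_prod sqmodM sqmod_prod.
by congr (_ * _); apply: eq_bigr => z _; rewrite !hornerE.
Qed.

(** Every root has [Im z <= 0], so it is no farther from [- 'i] than from ['i]. *)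
Lemma sqmod_horner_conj q : (forall t, 0 < complex.Im t -> q.[t] != 0) ->
  sqmod q.[- 'i] <= sqmod q.['i].
Proof.
move=> q0; have [r /allP rq qE] := sqmod_horner_roots q; rewrite !qE.
rewrite ler_wpM2l ?sqmod_ge0 // big_seq [leRHS]big_seq.
apply: ler_prod => z zr; rewrite sqmod_ge0 /=.
have : complex.Im z <= 0.
  by rewrite leNgt; apply/negP => /q0; rewrite -rootE rq.
by case: z {zr} => a b; rewrite /sqmod /=; nra.
Qed.

Lemma sqmod_horner_cubic q : (forall t, - 2^-1 < complex.Im t -> q.[t] != 0) ->
  sqmod q.[-1] * sqmod q.[(2^-1)%:C] ^+ 2 <= sqmod q.[0 +i* (3 / 8)] ^+ 3.
Proof.
move=> q0; have [r /allP rq qE] := sqmod_horner_roots q; rewrite !qE.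
set c := sqmod (lead_coef q).
set P1 := \prod_(z <- r) _; set P2 := \prod_(z <- r) _; set P3 := \prod_(z <- r) _.
rewrite (_ : _ * _ = c ^+ 3 * (P1 * P2 ^+ 2)); last by ring.
rewrite exprMn ler_wpM2l ?exprn_ge0 ?sqmod_ge0 //.
rewrite /P1 /P2 /P3 -!prodrXl -big_split /= big_seq [leRHS]big_seq.
apply: ler_prod => z zr; rewrite mulr_ge0 ?exprn_ge0 ?sqmod_ge0 //=.
have : complex.Im z <= - 2^-1.
  by rewrite leNgt; apply/negP => /q0; rewrite -rootE rq.
set X := sqmod (-1 - z); set Y := sqmod (_ - z); set Z := sqmod (_ - z) => hz.
have X0 : 0 <= X by exact: sqmod_ge0.
have Y0 : 0 <= Y by exact: sqmod_ge0.
(* The points -1 and 1/2 with weights 1 and 2 have mean 0, so the terms linear in [a] cancel and the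
   left side is [a ^ 2 + b ^ 2 + 1 / 2]. On the right, [b <= - 1 / 2] adds at least 33/64 to
   [a ^ 2 + b ^ 2]. *)
have XYZ : (X + 2 * Y) / 3 <= Z.
  move: hz; rewrite /X /Y /Z; case: z {zr X Y Z X0 Y0} => a b.
  by rewrite /sqmod /=; nra.
apply: le_trans (_ : ((X + 2 * Y) / 3) ^+ 3 <= _).
  rewrite -subr_ge0.
  rewrite (_ : _ - _ = (X - Y) ^+ 2 * (X + 8 * Y) / 27); last by field.
  by rewrite divr_ge0 // mulr_ge0 ?sqr_ge0 // addr_ge0 // mulr_ge0.
by rewrite lerXn2r // ?nnegrE ?sqmod_ge0 // divr_ge0 // addr_ge0 // mulr_ge0.
Qed.

(* [w] runs over the inverses of the opposites of the roots *)
Lemma poly_inverse_roots q : q.[0] = 1 ->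
    (forall t, 0 < complex.Im t -> q.[t] != 0) ->
  exists2 s : seq R[i], {in s, forall w, complex.Im w <= 0} &
    q = \prod_(w <- s) (1 + w *: 'X).
Proof.
move=> q01 q0; have [r qE] := closed_field_poly_normal q.
have rq z : z \in r -> q.[z] = 0.
  move=> zr; rewrite qE hornerZ horner_prod.
  by rewrite (big_rem z zr) /= hornerXsubC subrr mul0r mulr0.
have rn0 z : z \in r -> z != 0.
  by move=> /rq qz; apply: contra_eq_neq qz => ->; rewrite q01 oner_neq0.
exists [seq - z^-1 | z <- r].
  move=> _ /mapP [z zr ->]; have := rn0 _ zr; rewrite -sqmod_gt0.
  have : complex.Im z <= 0.
    by rewrite leNgt; apply/negP => /q0; rewrite rq ?eqxx.
  case: z {zr} => a b /= b0; rewrite /sqmod /= opprK => ab.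
  by rewrite pmulr_lle0 // invr_gt0.
(* Since [q] is 1 at 0, the leading coefficient is exactly what rescales each factor ['X - z] to
   [1 - z^-1 *: 'X]. *)
have cE : lead_coef q * \prod_(z <- r) (- z) = 1.
  rewrite -[RHS]q01 [in RHS]qE hornerZ horner_prod; congr (_ * _).
  by apply: eq_bigr => z _; rewrite !hornerE.
rewrite big_map {1}qE -[RHS]scale1r -[in RHS]cE -scalerA; congr (_ *: _).
rewrite -mul_polyC (big_morph _ (@polyCM _) (erefl : 1%:P = 1)) -big_split /=.
rewrite big_seq [RHS]big_seq; apply: eq_bigr => z /rn0 z0.
rewrite mul_polyC scalerDr scalerA mulrNN mulfV // scale1r addrC.
by rewrite alg_polyC polyCN.
Qed.

(** The last identity is Newton's formula for the second power sum; each new factor preserves it. *)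
Lemma coef_prod_1DX (s : seq R[i]) (q := \prod_(w <- s) (1 + w *: 'X)) :
  [/\ q`_0 = 1, q`_1 = \sum_(w <- s) w &
      q`_1 ^+ 2 - 2 * q`_2 = \sum_(w <- s) w ^+ 2].
Proof.
rewrite /q {q}; elim: s => [|w s [IH0 IH1 IH2]].
  by rewrite !big_nil !coef1; split => //=; rewrite expr0n mulr0 subr0.
rewrite !big_cons -IH1 -IH2 !mulrDl !mul1r -!scalerAl !coefD !coefZ !coefXM /=.
by rewrite IH0; split; ring.
Qed.

End SquaredModulus.

(** * Two-sided exponential bounds in terms of the first two coefficients *)

Section UnivariateGrowth.
Context {R : realType}.
Implicit Types (z w : R[i]) (q : {poly R[i]}).

Lemma sum_sqr_le_sqr_sum (I : eqType) (r : seq I) (F : I -> R) :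
  {in r, forall i, F i <= 0} ->
  \sum_(i <- r) F i ^+ 2 <= (\sum_(i <- r) F i) ^+ 2.
Proof.
elim: r => [|i r IH] F0; first by rewrite !big_nil expr0n.
rewrite !big_cons.
have Fi : F i <= 0 by rewrite F0 ?mem_head.
have Fr : {in r, forall j, F j <= 0} by move=> j jr; rewrite F0 // inE jr orbT.
have S0 : \sum_(j <- r) F j <= 0.
  by rewrite big_seq; apply: sumr_le0 => j /Fr.
by have := IH Fr; nra.
Qed.

(* The imaginary parts have a common sign, so the sum of their squares is at
   most the square of their sum, while [Re (w ^ 2) = |w| ^ 2 - 2 (Im w) ^ 2]. *)
Lemma sum_sqmod_le (s : seq R[i]) (q := \prod_(w <- s) (1 + w *: 'X)) :
  {in s, forall w, complex.Im w <= 0} ->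
  \sum_(w <- s) sqmod w <= sqmod q`_1 - 2 * complex.Re q`_2.
Proof.
move=> s0; have [_ q1 q2] := coef_prod_1DX s; rewrite -/q in q1 q2.
have -> : \sum_(w <- s) sqmod w =
    complex.Re (q`_1 ^+ 2 - 2 * q`_2) + 2 * \sum_(w <- s) complex.Im w ^+ 2.
  rewrite q2 Re_sum mulr_sumr -big_split /=; apply: eq_bigr => -[a b] _.
  by rewrite /sqmod expr2 /=; ring.
have := sum_sqr_le_sqr_sum _ s (@complex.Im R) s0; rewrite -Im_sum -q1.
case: (q`_1) (q`_2) => [a b] [c d]; rewrite /sqmod expr2 /=; lra.
Qed.

Lemma horner_prod_1DX (s : seq R[i]) t :
  (\prod_(w <- s) (1 + w *: 'X)).[t] = \prod_(w <- s) (1 + w * t).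
Proof. by rewrite horner_prod; apply: eq_bigr => w _; rewrite !hornerE. Qed.

Lemma sqmod_1D w : sqmod (1 + w) = 1 + 2 * complex.Re w + sqmod w.
Proof. by case: w => a b; rewrite /sqmod /=; ring. Qed.

(** Each factor satisfies [sqmod (1 + w * t) <= expR (2 * Re (w * t) + sqmod (w * t))]; the
    exponents are then summed using [sum_sqmod_le]. *)
Lemma sqmod_horner_le q t : q.[0] = 1 ->
    (forall u, 0 < complex.Im u -> q.[u] != 0) ->
  sqmod q.[t] <= expR (2 * complex.Re (q`_1 * t) +
                       sqmod t * (sqmod q`_1 - 2 * complex.Re q`_2)).
Proof.
move=> q01 /(poly_inverse_roots q q01) [s s0 ->].
have := sum_sqmod_le s s0; have [_ q1 _] := coef_prod_1DX s.
set p := \prod_(w <- s) _ in q1 *; rewrite horner_prod_1DX sqmod_prod => hs.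
apply: le_trans (_ : expR (2 * complex.Re (p`_1 * t) +
  sqmod t * \sum_(w <- s) sqmod w) <= _); last first.
  by rewrite ler_expR lerD2l ler_wpM2l ?sqmod_ge0.
rewrite q1 mulr_suml Re_sum !mulr_sumr -big_split /= expR_sum.
apply: ler_prod => w _; rewrite sqmod_ge0 sqmod_1D sqmodM /= (mulrC (sqmod t)).
by rewrite -addrA; exact: expR_ge1Dx.
Qed.

(* [expR (s / 3) >= 1 + s / 3] with [s = 5 / 3 * m - 2 * a]; for [a >= 0] the
   worst case is [m = a ^ 2], for [a < 0] it is [m = 5 / 4 * a ^ 2]. *)
Lemma expR_le_1DD (a m : R) : a ^+ 2 <= m -> (a < 0 -> 5 / 4 * a ^+ 2 <= m) ->
  expR (2 * a - 5 / 3 * m) <= 1 + 2 * a + m.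
Proof.
move=> am1 am2.
have m0 : 0 <= m by exact: le_trans (sqr_ge0 _) am1.
have pos1 : 0 <= 1 + 2 * a + m by have := sqr_ge0 (1 + a); nra.
have pos2 : 0 < 1 - 2 / 3 * a + 5 / 9 * m by have := sqr_ge0 (1 - a / 2); nra.
have E3 : (1 - 2 / 3 * a + 5 / 9 * m) ^+ 3 <= expR (5 / 3 * m - 2 * a).
  have -> : 5 / 3 * m - 2 * a = 3%:R * (5 / 9 * m - 2 / 3 * a) by field.
  rewrite expRM_natl lerXn2r ?nnegrE ?expR_ge0 ?(ltW pos2) //.
  by apply: le_trans (expR_ge1Dx _); lra.
suff P : 1 <= (1 + 2 * a + m) * (1 - 2 / 3 * a + 5 / 9 * m) ^+ 3.
  have -> : 2 * a - 5 / 3 * m = - (5 / 3 * m - 2 * a) by ring.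
  rewrite expRN -[leLHS]mul1r ler_pdivrMr ?expR_gt0 //.
  exact: le_trans P (ler_wpM2l pos1 E3).
(* Both factors increase with [m], so [m] may be lowered to its worst value. *)
have mono m' : m' <= m -> 0 <= 1 + 2 * a + m' ->
    0 <= 1 - 2 / 3 * a + 5 / 9 * m' ->
    (1 + 2 * a + m') * (1 - 2 / 3 * a + 5 / 9 * m') ^+ 3 <=
    (1 + 2 * a + m) * (1 - 2 / 3 * a + 5 / 9 * m) ^+ 3.
  move=> m'm h1 h2; apply: ler_pM; rewrite ?exprn_ge0 //; first lra.
  by rewrite lerXn2r ?nnegrE ?(ltW pos2) //; lra.
have [a0|a0] := ltP a 0.
  have sq : 0 <= a ^+ 2 by exact: sqr_ge0.
  apply: le_trans (mono (5 / 4 * a ^+ 2) (am2 a0) _ _); last 2 first.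
  - by have := sqr_ge0 (1 + 5 / 4 * a); nra.
  - lra.
  set t := - a; have t0 : 0 < t by rewrite oppr_gt0.
  have -> : a = - t by rewrite opprK.
  rewrite -subr_ge0 (_ : _ - _ = t ^+ 2 * (2 / 3 - 34 / 27 * t +
    107 / 216 * t ^+ 2 + 5 / 81 * t ^+ 3 + (10 / 9) ^+ 3 * t ^+ 4 +
    25 * (5 / 18) ^+ 3 * t ^+ 5 + 5 / 4 * (25 / 36) ^+ 3 * t ^+ 6)); last by field.
  apply: mulr_ge0; first exact: sqr_ge0.
  have h5 : 0 <= t ^+ 5 by rewrite exprn_ge0 // ltW.
  have h6 : 0 <= t ^+ 6 by rewrite exprn_ge0 // ltW.
  have h3 : 0 <= t ^+ 3 by rewrite exprn_ge0 // ltW.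
  (* Only the linear term is negative. Replacing [t ^ 4] by its tangent in [t ^ 2] at 1/2 leaves a
     quadratic of negative discriminant, with its minimum near 1/3. *)
  have h4 : 2 * (1 / 2) * t ^+ 2 - (1 / 2) ^+ 2 <= t ^+ 4.
    have := sqr_ge0 (t ^+ 2 - 1 / 2); rewrite sqrrB -exprM; lra.
  have := sqr_ge0 (t - 1 / 3); nra.
apply: le_trans (mono (a ^+ 2) am1 _ _); last 2 first.
- by have := sqr_ge0 (1 + a); nra.
- by have := sqr_ge0 (1 - a / 2); nra.
rewrite -subr_ge0 (_ : _ - _ = a ^+ 3 * (40 / 27 - 10 / 27 * a +
  16 / 81 * a ^+ 2 + a ^+ 3 * (440 / 729 - 200 / 729 * a + 125 / 729 * a ^+ 2)));
  last by field.
have a3 : 0 <= a ^+ 3 by exact: exprn_ge0.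
apply: (mulr_ge0 a3); apply: addr_ge0; last apply: (mulr_ge0 a3).
- by have := sqr_ge0 (a - 1); nra.
- by have := sqr_ge0 (a - 1); nra.
Qed.

(** The point [t] lies off the real axis to keep the factors [1 + w * t] away from 0. Multiplication
    by [t] rotates the lower half-plane by arctan(1/2), so a negative [Re (w * t)] forces
    [|Im (w * t)| >= |Re (w * t)| / 2]; this is the 5/4 condition of [expR_le_1DD]. *)
Lemma sqmod_horner_ge q (t := 1 +i* 2^-1) : q.[0] = 1 ->
    (forall u, 0 < complex.Im u -> q.[u] != 0) ->
  expR (2 * complex.Re (q`_1 * t) -
        5 / 3 * sqmod t * (sqmod q`_1 - 2 * complex.Re q`_2)) <= sqmod q.[t].
Proof.
move=> q01 /(poly_inverse_roots q q01) [s s0 ->].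
have := sum_sqmod_le s s0; have [_ q1 _] := coef_prod_1DX s.
set p := \prod_(w <- s) _ in q1 *; rewrite horner_prod_1DX sqmod_prod => hs.
have t53 : 0 <= 5 / 3 * sqmod t by rewrite mulr_ge0 ?sqmod_ge0 //; lra.
apply: le_trans (_ : expR (2 * complex.Re (p`_1 * t) -
  5 / 3 * sqmod t * \sum_(w <- s) sqmod w) <= _).
  by rewrite ler_expR lerD2l lerN2 ler_wpM2l.
rewrite q1 mulr_suml Re_sum !mulr_sumr -sumrB expR_sum big_seq [leRHS]big_seq.
apply: ler_prod => w ws; rewrite expR_ge0 sqmod_1D /= -mulrA -sqmodM [t * w]mulrC.
have := s0 w ws; case: w {ws} => a b /= b0; apply: expR_le_1DD.
  by rewrite /sqmod /= lerDl sqr_ge0.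
by rewrite /sqmod /=; nra.
Qed.

End UnivariateGrowth.

(** * Restriction of a stable polynomial to complex lines *)

Section LineRestriction.
Context {n : nat} {R : rcfType}.
Implicit Types (f : mpoly.mpoly n R[i]) (p v : 'I_n -> R[i]) (x y Y : 'I_n -> R).

Definition line_restr f p v : {poly R[i]} :=
  mpoly.mmap polyC (fun i => (p i)%:P + v i *: 'X) f.

Lemma horner_line_restr f p v t :
  (line_restr f p v).[t] = mpoly.meval (fun i => p i + v i * t) f.
Proof.
rewrite /line_restr /mpoly.mmap mpoly.mevalE horner_sum.
apply: eq_bigr => m _; rewrite hornerM hornerC horner_prod; congr (_ * _).
by apply: eq_bigr => i _; rewrite horner_exp !hornerE.
Qed.

Lemma sqmod_meval_mono f x y Y : stable f -> (forall i, 0 < Y i) ->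
  (forall i, `|y i| <= Y i) ->
  sqmod (mpoly.meval (fun i => x i +i* y i) f) <=
  sqmod (mpoly.meval (fun i => x i +i* Y i) f).
Proof.
move=> sf Y0 yY.
(* The line is chosen to pass through [x + i y] at [- 'i] and through [x + i Y] at ['i]. *)
pose q := line_restr f (fun i => x i +i* ((Y i + y i) / 2))
                       (fun i => ((Y i - y i) / 2)%:C).
have -> : mpoly.meval (fun i => x i +i* y i) f = q.[- 'i].
  rewrite horner_line_restr; apply: mpoly.meval_eq => i.
  by apply/eqP; rewrite eq_complex /=; apply/andP; split; apply/eqP; field.
have -> : mpoly.meval (fun i => x i +i* Y i) f = q.['i].
  rewrite horner_line_restr; apply: mpoly.meval_eq => i.
  by apply/eqP; rewrite eq_complex /=; apply/andP; split; apply/eqP; field.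
apply: sqmod_horner_conj => -[a b] /= b0.
rewrite horner_line_restr; apply: sf => i /=.
(* The terms [Y + y] and [b * (Y - y)] are nonnegative and cannot both vanish, since [Y > 0]. *)
have := Y0 i; have := yY i; rewrite ler_norml => /andP[h1 h2] h3.
have [h|h] := ltP 0 (Y i + y i); nra.
Qed.

Lemma sqmod_meval_cubic f x r : stable f -> 0 < r -> (forall i, `|x i| <= r) ->
  sqmod (mpoly.meval (fun i => x i +i* r) f) *
  sqmod (mpoly.meval (fun i => ((3 * r - x i) / 2) +i* r) f) ^+ 2 <=
  sqmod (mpoly.meval (fun i => r +i* (7 / 4 * r)) f) ^+ 3.
Proof.
move=> sf r0 xr.
pose q := line_restr f (fun i => r +i* r) (fun i => (r - x i)%:C).
have -> : mpoly.meval (fun i => x i +i* r) f = q.[-1].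
  rewrite horner_line_restr; apply: mpoly.meval_eq => i.
  by apply/eqP; rewrite eq_complex /=; apply/andP; split; apply/eqP; ring.
have -> : mpoly.meval (fun i => ((3 * r - x i) / 2) +i* r) f = q.[(2^-1)%:C].
  rewrite horner_line_restr; apply: mpoly.meval_eq => i.
  by apply/eqP; rewrite eq_complex /=; apply/andP; split; apply/eqP; field.
(* As [0 <= r - x <= 2 * r], the imaginary part [r + b * (r - x)] stays positive for
   [b > - 1 / 2]. *)
apply: le_trans (sqmod_horner_cubic q _) _ => [[a b] /= b0|].
  rewrite horner_line_restr; apply: sf => i /=.
  have := xr i; rewrite ler_norml => /andP[h1 h2].
  have [h|h] := ltP 0 (r + x i); nra.
rewrite lerXn2r ?nnegrE ?sqmod_ge0 //.
(* The height [r + 3 / 8 * (r - x)] is at most [7 / 4 * r], to which monotonicity raises it. *)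
have -> : q.[0 +i* (3 / 8)] =
    mpoly.meval (fun i => r +i* (r + 3 / 8 * (r - x i))) f.
  rewrite horner_line_restr; apply: mpoly.meval_eq => i.
  by apply/eqP; rewrite eq_complex /=; apply/andP; split; apply/eqP; field.
apply: sqmod_meval_mono => // i; first by rewrite mulr_gt0 // divr_gt0.
by have := xr i; rewrite !ler_norml => /andP[h1 h2]; lra.
Qed.

Lemma coef_line_restr0 f v k : (line_restr f (fun=> 0) v)`_k =
  \sum_(m <- mpoly.msupp f | mpoly.mdeg m == k)
     mpoly.mcoeff m f * mpoly.mmap1 v m.
Proof.
rewrite [RHS]big_mkcond /line_restr /mpoly.mmap coef_sum; apply: eq_bigr => m _.
rewrite coefCM /mpoly.mmap1.
under eq_bigr do rewrite add0r exprZn.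
rewrite scaler_prod prodrXr -mpoly.mdegE coefZ coefXn eq_sym.
by case: eqP; rewrite ?mulr1 ?mulr0.
Qed.

(** This writes a single coefficient as a sum over the support, so that sums over indices can be
    exchanged with sums over monomials. *)
Lemma sum_msupp_pred1 (V : nmodType) f (F : mpoly.multinom n -> V) m :
  (forall k : mpoly.multinom n, k \notin mpoly.msupp f -> F k = 0) ->
  \sum_(m' <- mpoly.msupp f | m' == m) F m' = F m.
Proof.
move=> F0; have [mf|mf] := boolP (m \in mpoly.msupp f).
  rewrite big_mkcond (bigD1_seq m) ?mpoly.msupp_uniq //= eqxx big1 ?addr0 //.
  by move=> k /negbTE ->.
rewrite F0 // big_seq_cond big1 // => m' /andP[m'f /eqP m'm].
by rewrite -m'm m'f in mf.
Qed.

Lemma coef1_line_restr0 f v : (line_restr f (fun=> 0) v)`_1 =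
  \sum_(i < n) mpoly.mcoeff (mpoly.mnm1 i) f * v i.
Proof.
pose F m := mpoly.mcoeff m f * mpoly.mmap1 v m.
have F0 m : m \notin mpoly.msupp f -> F m = 0.
  by move=> /mpoly.memN_msupp_eq0 mf; rewrite /F mf mul0r.
transitivity (\sum_(i < n) F (mpoly.mnm1 i)); last first.
  by apply: eq_bigr => i _; rewrite /F mpoly.mmap1U.
under eq_bigr do rewrite -(sum_msupp_pred1 _ _ _ _ F0) big_mkcond.
rewrite exchange_big coef_line_restr0 big_mkcond /=; apply: eq_bigr => m _.
rewrite -big_mkcond /=; case: mpoly.mdeg1P => [[i /eqP ->]|m1].
  by rewrite (eq_bigl (pred1 i)) ?big_pred1_eq // => j; rewrite mpoly.eq_mnm1 eq_sym.
by rewrite big1 // => i /eqP mi; case: m1; exists i; rewrite mi.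
Qed.

Lemma mdeg2_split (m : mpoly.multinom n) : mpoly.mdeg m = 2%N ->
  exists i j, m = mpoly.mnm_add (mpoly.mnm1 i) (mpoly.mnm1 j).
Proof.
move=> m2.
have [i mi] : exists i, m i != 0%N.
  apply/existsP; rewrite -negb_forall; apply/negP => /forallP m0.
  by move: m2; rewrite mpoly.mdegE big1 // => i _; apply/eqP/m0.
have mE : mpoly.mnm_add (mpoly.mnm_sub m (mpoly.mnm1 i)) (mpoly.mnm1 i) = m.
  by rewrite mpoly.submK // mpoly.lep1mP.
have /mpoly.mdeg1P [j /eqP mj] :
    mpoly.mdeg (mpoly.mnm_sub m (mpoly.mnm1 i)) == 1%N.
  by rewrite -eqSS -addn1 -[X in (_ + X)%N](mpoly.mdeg1 i) -mpoly.mdegD mE m2.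
by exists j, i; rewrite -mj mE.
Qed.

(** Every monomial of degree 2 arises from at least one ordered pair [(i, j)]; those with [i != j]
    are counted twice, which only enlarges the upper bound. *)
Lemma cmod_coef2_line_restr0 f v rho : (forall i, cmod (v i) <= rho) ->
  cmod (line_restr f (fun=> 0) v)`_2 <= rho ^+ 2 *
  \sum_(i < n) \sum_(j < n)
    cmod (mpoly.mcoeff (mpoly.mnm_add (mpoly.mnm1 i) (mpoly.mnm1 j)) f).
Proof.
move=> vrho.
have cmod_mmap1 m : cmod (mpoly.mmap1 v m) <= rho ^+ mpoly.mdeg m.
  rewrite mpoly.mdegE -prodrXr (big_morph _ cmodM cmod1).
  apply: ler_prod => i _; rewrite cmod_ge0.
  have -> : cmod (v i ^+ m i) = cmod (v i) ^+ m i.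
    by elim: (m i) => [|k IH]; rewrite ?expr0 ?cmod1 // !exprS cmodM IH.
  by rewrite lerXn2r ?nnegrE ?cmod_ge0 // (le_trans _ (vrho i)) ?cmod_ge0.
pose F m := cmod (mpoly.mcoeff m f).
have F0 m : m \notin mpoly.msupp f -> F m = 0.
  by move=> /mpoly.memN_msupp_eq0 mf; rewrite /F mf cmod0.
rewrite coef_line_restr0; apply: le_trans (cmod_sum _ _ _ _) _.
apply: le_trans (_ : rho ^+ 2 *
    \sum_(m <- mpoly.msupp f | mpoly.mdeg m == 2%N) F m <= _).
  rewrite mulr_sumr; apply: ler_sum => m /eqP m2; rewrite cmodM mulrC.
  by rewrite ler_wpM2r ?cmod_ge0 // -m2.
rewrite ler_wpM2l ?sqr_ge0 // pair_bigA /= -/F.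
pose G (ij : 'I_n * 'I_n) := mpoly.mnm_add (mpoly.mnm1 ij.1) (mpoly.mnm1 ij.2).
rewrite -[leRHS]/(\sum_ij F (G ij)).
under [leRHS]eq_bigr do rewrite -(sum_msupp_pred1 _ _ _ _ F0) big_mkcond.
rewrite exchange_big big_mkcond /=; apply: ler_sum => m _.
case: eqP => [/mdeg2_split [i [j mij]]|_].
  rewrite (bigD1 (i, j)) //= {1}/G -mij eqxx lerDl; apply: sumr_ge0 => ij _.
  by case: ifP; rewrite ?cmod_ge0.
by apply: sumr_ge0 => ij _; case: ifP; rewrite ?cmod_ge0.
Qed.

End LineRestriction.

(** * Numerical bounds on e and bookkeeping of exponents *)

Section Constants.
Context {R : realType}.

Lemma expR2_ge (x a b : R) : 0 <= a -> a <= expR x -> b <= a ^+ 2 ->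
  b <= expR (2 * x).
Proof.
move=> a0 ax ba; rewrite (expRM_natl 2); apply: le_trans ba _.
by rewrite lerXn2r ?nnegrE ?expR_ge0.
Qed.

Lemma expR2_le (x a b : R) : expR x <= a -> a ^+ 2 <= b -> expR (2 * x) <= b.
Proof.
move=> ax ab; rewrite (expRM_natl 2); apply: le_trans ab.
by rewrite lerXn2r ?nnegrE ?expR_ge0 // (le_trans _ ax) ?expR_ge0.
Qed.

Lemma expR_le_of_1B (x a : R) : x < 1 -> 1 <= a * (1 - x) -> expR x <= a.
Proof.
rewrite -subr_gt0 => x1; rewrite -ler_pdivrMr // div1r; apply: le_trans.
rewrite -[x in expR x]opprK expRN lef_pV2 ?posrE ?expR_gt0 //.
exact: expR_ge1Dx.
Qed.

(* Six squarings of [65 / 64 <= expR (1 / 64)], rounded down. *)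
Lemma expR1_ge : 269 / 100 <= expR 1 :> R.
Proof.
have h0 : 65 / 64 <= expR (1 / 64 : R).
  by apply: le_trans (expR_ge1Dx _); lra.
have h1 : 295 / 286 <= expR (2 * (1 / 64) : R).
  apply: (expR2_ge _ (65 / 64) _ _ h0); lra.
have h2 : 233 / 219 <= expR (2 * (2 * (1 / 64)) : R).
  apply: (expR2_ge _ (295 / 286) _ _ h1); lra.
have h3 : 429 / 379 <= expR (2 * (2 * (2 * (1 / 64))) : R).
  apply: (expR2_ge _ (233 / 219) _ _ h2); lra.
have h4 : 41 / 32 <= expR (2 * (2 * (2 * (2 * (1 / 64)))) : R).
  apply: (expR2_ge _ (429 / 379) _ _ h3); lra.
have h5 : 371 / 226 <= expR (2 * (2 * (2 * (2 * (2 * (1 / 64))))) : R).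
  apply: (expR2_ge _ (41 / 32) _ _ h4); lra.
have h6 : 269 / 100 <= expR (2 * (2 * (2 * (2 * (2 * (2 * (1 / 64)))))) : R).
  apply: (expR2_ge _ (371 / 226) _ _ h5); lra.
rewrite (_ : expR 1 = expR (2 * (2 * (2 * (2 * (2 * (2 * (1 / 64)))))))); first exact: h6.
by congr expR; field.
Qed.

(* Five squarings of [expR (1 / 32) <= 32 / 31], rounded up. *)
Lemma expR1_le : expR 1 <= 139 / 50 :> R.
Proof.
have h0 : expR (1 / 32 : R) <= 32 / 31.
  by apply: expR_le_of_1B; lra.
have h1 : expR (2 * (1 / 32) : R) <= 65 / 61.
  apply: (expR2_le _ (32 / 31) _ h0); lra.
have h2 : expR (2 * (2 * (1 / 32)) : R) <= 285 / 251.
  apply: (expR2_le _ (65 / 61) _ h1); lra.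
have h3 : expR (2 * (2 * (2 * (1 / 32))) : R) <= 361 / 280.
  apply: (expR2_le _ (285 / 251) _ h2); lra.
have h4 : expR (2 * (2 * (2 * (2 * (1 / 32)))) : R) <= 630 / 379.
  apply: (expR2_le _ (361 / 280) _ h3); lra.
have h5 : expR (2 * (2 * (2 * (2 * (2 * (1 / 32))))) : R) <= 139 / 50.
  apply: (expR2_le _ (630 / 379) _ h4); lra.
rewrite (_ : expR 1 = expR (2 * (2 * (2 * (2 * (2 * (1 / 32))))))); first exact: h5.
by congr expR; field.
Qed.

(** After squaring, this reads [2 * e ^ 2 - 7 * e + 4 <= 0], whose larger root is (7 + sqrt 17) / 4
    = 2.7807...; this dictates the precision of [expR1_le]. *)
Lemma constant_ge2 (e := expR (1 : R)) :
  2 <= Num.sqrt (2 * e ^+ 2 - e) / (e - 1).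
Proof.
have e1 : 269 / 100 <= e := expR1_ge; have e2 : e <= 139 / 50 := expR1_le.
have e10 : 0 < e - 1 by lra.
rewrite ler_pdivlMr // -[leLHS]ger0_norm; last by rewrite mulr_ge0 // ltW.
by rewrite -sqrtr_sqr; apply: ler_wsqrtr; nra.
Qed.

Lemma le_expR_cubic (S T V l u : R) : 0 <= S -> 0 <= V ->
  S * T ^+ 2 <= V ^+ 3 -> expR l <= T -> V <= expR u ->
  S <= expR (3 * u - 2 * l).
Proof.
move=> S0 V0 STV lT Vu; rewrite expRD expRN ler_pdivlMr ?expR_gt0 //.
rewrite (expRM_natl 3) (expRM_natl 2); apply: le_trans (le_trans STV _).
  have T0 : 0 <= T by exact: le_trans (expR_ge0 _) lT.
  by rewrite ler_wpM2l // lerXn2r ?nnegrE ?expR_ge0.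
by rewrite lerXn2r ?nnegrE ?expR_ge0.
Qed.

(* The linear term is absorbed by AM-GM, which costs the additive [1 / 2]. *)
Lemma exponent_le (e r A D : R) : 269 / 100 <= e -> 0 <= D ->
  21 / 2 * (r * A) + 1385 / 48 * (r ^+ 2 * (A ^+ 2 + 2 * D)) <=
  1 / 2 + 2 * ((6 * e ^+ 2 * A ^+ 2 + 4 * e ^+ 2 * D) * r ^+ 2).
Proof.
(* The tight coefficient is that of [D]: it requires [1385 / 24 <= 8 * e ^ 2], that is
   [e >= 2.686]. *)
move=> e_ge D0; have e2 : 7236 / 1000 <= e ^+ 2 by nra.
(* Multiplied by 441/8, this square gives [21 / 2 * (r * A) <= 1 / 2 + 441 / 8 * (r * A) ^ 2]. *)
have s2 := sqr_ge0 (r * A - 2 / 21); rewrite sqrrB exprMn in s2.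
have hA : 7236 / 1000 * (r ^+ 2 * A ^+ 2) <= e ^+ 2 * (r ^+ 2 * A ^+ 2).
  by rewrite ler_wpM2r // mulr_ge0 ?sqr_ge0.
have hD : 7236 / 1000 * (r ^+ 2 * D) <= e ^+ 2 * (r ^+ 2 * D).
  by rewrite ler_wpM2r // mulr_ge0 ?sqr_ge0.
have D0' : 0 <= r ^+ 2 * D by rewrite mulr_ge0 ?sqr_ge0.
have A0' : 0 <= r ^+ 2 * A ^+ 2 by rewrite mulr_ge0 ?sqr_ge0.
lra.
Qed.

(** For [v] in [[r, 2 r]] the two weights have absolute values at most [2 * r] and [17 / 2 * r],
    which add up to [21 / 2 * r]. *)
Lemma linear_term_le (a b c r v : R) : `|a| <= c -> `|b| <= c ->
  r <= v -> v <= 2 * r ->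
  a * (6 * r - 4 * v) - b * (21 / 2 * r - 2 * v) <= 21 / 2 * (r * c).
Proof.
rewrite !ler_norml => /andP[a1 a2] /andP[b1 b2] v1 v2.
have Pa : a * (6 * r - 4 * v) <= c * (2 * r) by nra.
have Pb : - b * (21 / 2 * r - 2 * v) <= c * (17 / 2 * r) by nra.
lra.
Qed.

End Constants.

(** * Bounds along real rays and their transfer to the polydisc *)

Section RayBounds.
Context {n : nat} {R : realType}.
Context (f : mpoly.mpoly n R[i]).
Context (f0 : mpoly.mcoeff mpoly.mnm0 f = 1) (sf : stable f).

Lemma horner0_line_restr0 v : (line_restr f (fun=> 0) v).[0] = 1.
Proof.
rewrite horner_coef0 coef_line_restr0.
under eq_bigl do rewrite mpoly.mdeg_eq0.
rewrite sum_msupp_pred1 => [|m /mpoly.memN_msupp_eq0 ->]; last by rewrite mul0r.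
by rewrite f0 mpoly.mmap11 mulr1.
Qed.

Lemma meval_zero v : (forall i, v i = 0) -> mpoly.meval v f = 1.
Proof.
move=> v0; rewrite -(horner0_line_restr0 v) horner_line_restr.
by apply: mpoly.meval_eq => i; rewrite v0 mul0r addr0.
Qed.

Let A := \sum_(i < n) cmod (mpoly.mcoeff (mpoly.mnm1 i) f).
Let D := \sum_(i < n) \sum_(j < n)
  cmod (mpoly.mcoeff (mpoly.mnm_add (mpoly.mnm1 i) (mpoly.mnm1 j)) f).

Lemma line_restr_coef_bound v rho (q := line_restr f (fun=> 0) v) :
  0 <= rho -> (forall i, cmod (v i) <= rho) ->
  sqmod q`_1 - 2 * complex.Re q`_2 <= rho ^+ 2 * (A ^+ 2 + 2 * D).
Proof.
move=> rho0 vrho.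
have q1 : sqmod q`_1 <= (rho * A) ^+ 2.
  have A0 : 0 <= A by apply: sumr_ge0 => i _; exact: cmod_ge0.
  rewrite -cmod_sqr lerXn2r ?nnegrE ?cmod_ge0 ?mulr_ge0 //.
  rewrite /q coef1_line_restr0; apply: le_trans (cmod_sum _ _ _ _) _.
  rewrite mulr_sumr; apply: ler_sum => i _; rewrite cmodM mulrC.
  by rewrite ler_wpM2r ?cmod_ge0.
have q2 : - complex.Re q`_2 <= rho ^+ 2 * D.
  apply: le_trans (ler_norm _) _; rewrite normrN.
  exact: le_trans (normr_Re_le_cmod _) (cmod_coef2_line_restr0 _ _ _ vrho).
rewrite exprMn in q1; lra.
Qed.

Lemma stable_line_restr0 (nu : 'I_n -> R) : (forall i, 0 < nu i) ->
  forall t, 0 < complex.Im t ->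
    (line_restr f (fun=> 0) (fun i => (nu i)%:C)).[t] != 0.
Proof.
move=> nu0 [a b] /= b0; rewrite horner_line_restr; apply: sf => i /=.
by rewrite mul0r addr0 add0r mulr_gt0.
Qed.

Lemma sqmod_meval_le (z : 'I_n -> R[i]) r : 0 < r ->
  (forall i, cmod (z i) <= r) ->
  sqmod (mpoly.meval z f) <=
  expR (21 / 2 * (r * A) + 1385 / 48 * (r ^+ 2 * (A ^+ 2 + 2 * D))).
Proof.
move=> r0 zr.
pose x i := complex.Re (z i); pose y i := complex.Im (z i).
have xr i : `|x i| <= r by exact: le_trans (normr_Re_le_cmod _) (zr i).
have yr i : `|y i| <= r by exact: le_trans (normr_Im_le_cmod _) (zr i).
pose nu i := (3 * r - x i) / 2.
have nu1 i : r <= nu i by have := xr i; rewrite ler_norml /nu => /andP[]; lra.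
have nu2 i : nu i <= 2 * r by have := xr i; rewrite ler_norml /nu => /andP[]; lra.
pose q1 := line_restr f (fun=> 0) (fun=> r%:C).
pose q2 := line_restr f (fun=> 0) (fun i => (nu i)%:C).
pose W := r ^+ 2 * (A ^+ 2 + 2 * D).
have cmodr (a : R) : 0 <= a -> cmod a%:C = a.
  by move=> a0; rewrite /cmod /= expr0n addr0 sqrtr_sqr ger0_norm.
have W1 : sqmod q1`_1 - 2 * complex.Re q1`_2 <= W.
  by apply: line_restr_coef_bound => [|i]; rewrite ?cmodr // ltW.
have W2 : sqmod q2`_1 - 2 * complex.Re q2`_2 <= 4 * W.
  have -> : 4 * W = (2 * r) ^+ 2 * (A ^+ 2 + 2 * D) by rewrite /W; ring.
  apply: line_restr_coef_bound => [|i]; first by rewrite mulr_ge0 // ltW.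
  by rewrite cmodr // (le_trans (ltW r0)).
pose t1 : R[i] := 1 +i* (7 / 4); pose t2 : R[i] := 1 +i* 2^-1.
have st1 : sqmod t1 = 65 / 16 by rewrite /sqmod /=; field.
have st2 : sqmod t2 = 5 / 4 by rewrite /sqmod /=; field.
have U : sqmod (mpoly.meval (fun i => r +i* (7 / 4 * r)) f) <=
    expR (2 * complex.Re (q1`_1 * t1) + 65 / 16 * W).
  have -> : mpoly.meval (fun i => r +i* (7 / 4 * r)) f = q1.[t1].
    rewrite horner_line_restr; apply: mpoly.meval_eq => i.
    by apply/eqP; rewrite eq_complex /=; apply/andP; split; apply/eqP; field.
  apply: le_trans (sqmod_horner_le _ _ (horner0_line_restr0 _) _) _.
    exact: (stable_line_restr0 (fun=> r)).
  by rewrite ler_expR lerD2l st1 ler_wpM2l //; lra.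
have L : expR (2 * complex.Re (q2`_1 * t2) - 25 / 3 * W) <=
    sqmod (mpoly.meval (fun i => nu i +i* r) f).
  (* The ray point [(1 + i / 2) nu] has heights [nu / 2 <= r]; raising them to [r] gives the point
     that occurs in [sqmod_meval_cubic]. *)
  apply: le_trans (_ : sqmod (mpoly.meval (fun i => nu i +i* (nu i / 2)) f) <= _).
    have -> : mpoly.meval (fun i => nu i +i* (nu i / 2)) f = q2.[t2].
      rewrite horner_line_restr; apply: mpoly.meval_eq => i.
      by apply/eqP; rewrite eq_complex /=; apply/andP; split; apply/eqP; field.
    apply: le_trans (sqmod_horner_ge _ (horner0_line_restr0 _) _).
      rewrite ler_expR lerD2l lerN2 -/t2 st2 -/q2; lra.
    by apply: stable_line_restr0 => i; exact: lt_le_trans (nu1 i).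
  apply: sqmod_meval_mono => // i.
  have nu0 : 0 < nu i by exact: lt_le_trans (nu1 i).
  rewrite ger0_norm; first by have := nu2 i; lra.
  by rewrite ltW // divr_gt0.
have zE : mpoly.meval z f = mpoly.meval (fun i => x i +i* y i) f.
  by apply: mpoly.meval_eq => i; rewrite /x /y; case: (z i).
rewrite zE; apply: le_trans (sqmod_meval_mono _ x y (fun=> r) sf _ yr) _ => //.
(* Three times the upper exponent minus twice the lower one: the quadratic part has coefficient
   [3 * 65 / 16 + 2 * 25 / 3 = 1385 / 48]. *)
apply: le_trans (le_expR_cubic _ _ _ _ _ (sqmod_ge0 _) (sqmod_ge0 _)
  (sqmod_meval_cubic f x r sf r0 xr) L U) _.
rewrite ler_expR -/W; clear U L W1 W2 st1 st2 xr yr zr.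
suff H : 6 * complex.Re (q1`_1 * t1) - 4 * complex.Re (q2`_1 * t2) <=
  21 / 2 * (r * A) by lra.
rewrite /q1 /q2 !coef1_line_restr0 !mulr_suml !Re_sum !mulr_sumr -sumrB.
apply: ler_sum => i _.
apply: le_trans (linear_term_le _ _ _ _ _ (normr_Re_le_cmod _)
  (normr_Im_le_cmod _) (nu1 i) (nu2 i)).
by case: (mpoly.mcoeff _ _) => a b; rewrite le_eqVlt; apply/orP; left;
  apply/eqP => /=; field.
Qed.

End RayBounds.

(* The growth bound with the stated constants *)
Local Close Scope complex_scope.

Theorem theorem5p5 (R : realType) (n : nat) (f : mpoly.mpoly n R[i]) :
  mpoly.mcoeff (@mpoly.mnm0 n) f = 1 ->
  stable f ->
  let e := expR (1 : R) in
  let B := 2 ^+ n / 2 * (Num.sqrt (2 * e ^+ 2 - e) / (e - 1)) in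
  let C := 6 * e ^+ 2 * (\sum_(i < n) cmod (mpoly.mcoeff (mpoly.mnm1 i) f)) ^+ 2
           + 4 * e ^+ 2 * \sum_(i < n) \sum_(j < n)
                 cmod (mpoly.mcoeff (mpoly.mnm_add (mpoly.mnm1 i) (mpoly.mnm1 j)) f) in
  forall r : R, 0 <= r ->
  forall z : 'I_n -> R[i], (forall i, cmod (z i) <= r) ->
    cmod (mpoly.meval z f) <= B * expR (C * r ^+ 2).
Proof.
move=> f0 sf e B C r r0 z zr.
have e_ge : 269 / 100 <= e := expR1_ge.
have D0 : 0 <= \sum_(i < n) \sum_(j < n)
    cmod (mpoly.mcoeff (mpoly.mnm_add (mpoly.mnm1 i) (mpoly.mnm1 j)) f).
  by apply: sumr_ge0 => i _; apply: sumr_ge0 => j _; exact: cmod_ge0.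
have C0 : 0 <= C.
  by rewrite addr_ge0 // mulr_ge0 ?sqr_ge0 // mulr_ge0 ?sqr_ge0.
have B_ge : 2 ^+ n <= B.
  have p0 : 0 <= 2 ^+ n / 2 :> R by rewrite divr_ge0 // exprn_ge0.
  by have := ler_wpM2l p0 constant_ge2; rewrite divfK // pnatr_eq0.
(* This covers [n = 0] and [r = 0], where [z] vanishes and [f] takes the value 1. *)
have trivial_case : (forall i, z i = 0) ->
    cmod (mpoly.meval z f) <= B * expR (C * r ^+ 2).
  move=> z0; rewrite (meval_zero f f0 z z0) cmod1 -[1]mulr1 ler_pM //.
    by apply: le_trans B_ge; exact: exprn_ege1 (ler1n _ 2).
  by rewrite -expR0 ler_expR mulr_ge0 ?sqr_ge0.
have [n0|n0] := posnP n.
  by apply: trivial_case => -[i ilt]; exfalso; rewrite n0 in ilt.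
move: r0; rewrite le_eqVlt => /orP[/eqP r0|r0].
  apply: trivial_case => i; apply: ComplexField.Normc.eq0_normc.
  by apply/eqP; rewrite -cmod_normc eq_le cmod_ge0 r0 zr.
have B2 : 2 <= B.
  by apply: le_trans B_ge; apply: ler_eXnr => //; exact: (ler1n _ 2).
have B0 : 0 <= B by exact: le_trans (ler0n _ 2) B2.
(* The additive 1/2 in [exponent_le] is absorbed here by [B ^ 2 >= 4]. *)
have half : expR (1 / 2 : R) <= B ^+ 2.
  apply: le_trans (_ : 2 ^+ 2 <= _); first by apply: expR_le_of_1B; lra.
  by rewrite lerXn2r ?nnegrE ?ler0n.
(* Both sides are squared to reach [sqmod], whence the factor 2 before the exponent in
   [exponent_le]. *)
rewrite -(@ler_pXn2r _ 2) ?nnegrE ?cmod_ge0 ?(mulr_ge0 B0) ?expR_ge0 //.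
rewrite cmod_sqr; apply: le_trans (sqmod_meval_le f f0 sf z r r0 zr) _.
rewrite exprMn -expRM_natl; apply: le_trans (ler_wpM2r (expR_ge0 _) half).
by rewrite -expRD ler_expR; exact: exponent_le.
Qed.
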